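(* For each $\tilde\delta>0$ there exists a balanced star-shaped domain $\Omega\subset\mathbb{R}^2$ with $\operatorname{vol}_2(\Omega)=\pi$ and $B(0,1-\tilde\delta)\subset\Omega\subset B(0,1+\tilde\delta)$ such that $\kappa(\Omega)>j_{1,1}$.
   Context: $B(0,R)$ is the open disk of radius $R$ centred at the origin (empty if $R\le0$), and $\operatorname{vol}_2$ is two-dimensional Lebesgue measure. Domains are bounded open sets. $\Omega$ is balanced if it is invariant under $\mathbf{x}\mapsto-\mathbf{x}$; star-shaped means star-shaped with respect to the origin. Let $\widehat{\chi_\Omega}(\boldsymbol{\xi})=\int_\Omega e^{i\boldsymbol{\xi}\cdot\mathbf{x}}\,d\mathbf{x}$, and let $\mathcal{N}(\Omega)=\{\boldsymbol{\xi}\in\mathbb{R}^2:\widehat{\chi_\Omega}(\boldsymbol{\xi})=0\}$. Set $\kappa(\Omega)=\min\{|\boldsymbol{\xi}|:\boldsymbol{\xi}\in\mathcal{N}(\Omega)\}$, with $\kappa(\Omega)=\infty$ if $\mathcal{N}(\Omega)=\emptyset$. $j_{1,1}$ is the first positive zero of the Bessel function $J_1$. *)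

(* Defs.v *)
From mathcomp Require Import all_boot all_order all_algebra.
From mathcomp Require Import all_classical all_reals all_analysis.
From mathcomp Require Import complex.

Set Implicit Arguments.
Unset Strict Implicit.
Unset Printing Implicit Defensive.
Import Order.TTheory GRing.Theory Num.Theory.
Import numFieldNormedType.Exports.
Local Open Scope classical_set_scope.
Local Open Scope ring_scope.

Section Plane.
Variable R : realType.
Implicit Types (x xi : R * R) (Omega : set (R * R)).

Definition dot2 xi x : R := xi.1 * x.1 + xi.2 * x.2.

(* The library norm on [R * R] is the sup norm; this is the Euclidean one. *)
Definition norm2 x : R := Num.sqrt (dot2 x x).

Definition disk (r : R) : set (R * R) := [set x | norm2 x < r].

Definition vol2 :
    {measure set (measurableTypeR R * measurableTypeR R)%type -> \bar R} :=
  (@lebesgue_measure R \x @lebesgue_measure R)%E.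

(* Connectedness is not part of this notion of domain. *)
Definition domain Omega : Prop := bounded_set Omega /\ open Omega.

Definition balanced Omega : Prop := [set - x | x in Omega] = Omega.

Definition star_shaped Omega : Prop :=
  forall x, Omega x -> forall t : R, 0 <= t <= 1 -> Omega (t *: x).

(* The integral over Omega of exp(i xi.x) = cos(xi.x) + i sin(xi.x). *)
Definition fourier_indic Omega xi : R[i] :=
  Complex (Rintegral vol2 Omega (fun x => cos (dot2 xi x)))
          (Rintegral vol2 Omega (fun x => sin (dot2 xi x))).

Definition null_set Omega : set (R * R) :=
  [set xi | fourier_indic Omega xi = 0].

(* For a bounded open Omega the set [null_set Omega] is closed, so that the
   infimum is a minimum when it is nonempty; [ereal_inf set0 = +oo]. *)
Definition kappa Omega : \bar R :=
  ereal_inf [set (norm2 xi)%:E | xi in null_set Omega].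

End Plane.
Arguments vol2 : clear implicits.

Section Bessel.
Variable R : realType.

(* The Bessel function J_n of the first kind, by its power series. *)
Definition besselJ (n : nat) (x : R) : R :=
  limn (series (fun m : nat =>
    (-1) ^+ m / (m`! * (m + n)`!)%:R * (x / 2) ^+ (2 * m + n))).

(* J_1 has positive zeros and they do not accumulate at 0 since J_1'(0) = 1/2,
   so the infimum is the least positive zero. *)
Definition j11 : R := inf [set x : R | 0 < x /\ besselJ 1 x = 0].

End Bessel.
Arguments j11 : clear implicits.

(* Main.v *)
(* The transform of a disk of radius r is pi r^2 A(|xi|^2 r^2 / 4), where
   J_1(x) = (x / 2) A(x^2 / 4); let z0 = j_{1,1}^2 / 4 be the first zero of A.
   Take the disk of squared radius 1 - b together with the part of the disk of
   squared radius 1 + 3b in the cone Re z^(2^k) > 0, Im z^(2^k) > 0.  Four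
   rotated copies of this cone tile the plane up to a null set, and the
   rotations tend to the identity as k grows; so the area is pi, and the
   transform is, up to an error vanishing as k grows, 3/4 of that of the small
   disk plus 1/4 of that of the large one.  At |xi| = j_{1,1} this combination
   vanishes to second order in b at b = 0, and its third derivative there is a
   positive multiple of J_2(j_{1,1}) > 0.  As A decreases slightly beyond z0,
   positivity at j_{1,1} gives a positive lower bound for |xi| up to some radius
   larger than j_{1,1}. *)
Require Import Defs.
From mathcomp Require Import all_boot all_order all_algebra.
From mathcomp Require Import all_classical all_reals all_analysis measurable_realfun.
From mathcomp Require Import ring lra.
Set Implicit Arguments.
Unset Strict Implicit.
Unset Printing Implicit Defensive.
Import Order.TTheory GRing.Theory Num.Theory.
Import numFieldNormedType.Exports.
Local Open Scope classical_set_scope.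
Local Open Scope ring_scope.

(** * The Bessel series *)

Section BesselSeries.
Variable R : realType.
Implicit Types (n m : nat) (z x : R).

Definition bescoef n m : R := (-1) ^+ m / (m`! * (m + n)`!)%:R.

(* [J_n x = (x / 2) ^+ n * bes n (x ^+ 2 / 4)]. *)
Definition bes n z : R := limn (pseries (bescoef n) z).

Lemma fact_neq0 n : n`!%:R != 0 :> R.
Proof. by rewrite pnatr_eq0 -lt0n fact_gt0. Qed.

(** As (m + n)! is at least 1, the series is dominated by the exponential series at [|z|]. *)
Lemma is_cvg_bes n z : cvgn (pseries (bescoef n) z).
Proof.
apply: normed_cvg.
apply: (@series_le_cvg _ _ (exp_coeff `|z|)).
- by move=> m; exact: normr_ge0.
- by move=> m; rewrite /exp_coeff /= divr_ge0// exprn_ge0.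
- move=> m; rewrite /exp_coeff /= /bescoef normrM normf_div normrX normrN1 expr1n.
  rewrite normrX mul1r mulrC ler_wpM2l ?exprn_ge0//.
  rewrite ger0_norm ?ler0n// lef_pV2 ?posrE ?ltr0n ?muln_gt0 ?fact_gt0//.
  by rewrite ler_nat leq_pmulr// fact_gt0.
- exact: is_cvg_series_exp_coeff.
Qed.

Lemma pseries_diffs_bescoef n : pseries_diffs (bescoef n) = - bescoef n.+1.
Proof.
apply/funext => m; rewrite /pseries_diffs /bescoef /= !fctE.
rewrite addSnnS factS !natrM exprS.
field; rewrite ?fact_neq0 ?andbT//.
by rewrite nat1r pnatr_eq0.
Qed.

Lemma pseriesN (c : R^nat) z : pseries (- c) z = - pseries c z.
Proof.
apply/funext => N; rewrite /pseries /series /= !fctE /= -sumrN.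
by apply: eq_bigr => i _; rewrite mulNr.
Qed.

(** Termwise differentiation turns the coefficients for [n] into minus those for [n.+1]. In the
    variable z = x^2 / 4 this is (x^(-n) J_n)' = - x^(-n) J_(n+1). *)
Lemma is_derive_bes n z : is_derive z 1 (bes n) (- bes n.+1 z).
Proof.
rewrite (_ : - bes n.+1 z = limn (pseries (pseries_diffs (bescoef n)) z)).
  apply: (@pseries_snd_diffs _ _ (`|z| + 1)).
  - exact: is_cvg_bes.
  - by rewrite pseries_diffs_bescoef pseriesN; apply: is_cvgN; exact: is_cvg_bes.
  - rewrite pseries_diffs_bescoef pseries_diffsN pseriesN; apply: is_cvgN.
    by rewrite pseries_diffs_bescoef pseriesN; apply: is_cvgN; exact: is_cvg_bes.
  - by rewrite [ltRHS]ger0_norm ?addr_ge0// ltrDl.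
by rewrite pseries_diffs_bescoef pseriesN limN//; exact: is_cvg_bes.
Qed.

Lemma continuous_bes n : continuous (bes n).
Proof.
move=> z; apply: differentiable_continuous; apply/derivable1_diffP.
by have [] := is_derive_bes n z.
Qed.

(** The recurrence J_n + J_(n+2) = (2 (n + 1) / x) J_(n+1), rewritten in z = x^2 / 4. *)
Lemma bes_rec n z : bes n z = n.+1%:R * bes n.+1 z - z * bes n.+2 z.
Proof.
(* The identity is exact on partial sums once the last series, multiplied by [z], is cut one term
   earlier. *)
have H N : pseries (bescoef n) z N.+1 =
    n.+1%:R * pseries (bescoef n.+1) z N.+1 - z * pseries (bescoef n.+2) z N.
  have S c M : pseries c z M.+1 = pseries c z M + c M * z ^+ M.
    by rewrite /pseries /series /= big_nat_recr.
  elim: N => [|N IH].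
    rewrite /pseries /series /= !big_nat_recr//= !big_nil /bescoef !add0r !fact0 !mul1n.
    rewrite !expr0 factS natrM.
    by field; rewrite fact_neq0 nat1r pnatr_eq0.
  rewrite (S (bescoef n)) IH (S (bescoef n.+1) N.+1) (S (bescoef n.+2)).
  move: (pseries _ _ _) (pseries _ _ _) => u v.
  rewrite /bescoef !addSn !addnS !factS !natrM !exprS.
  rewrite -!natr1 !natrD.
  field; rewrite fact_neq0 -!natrD ?nat1r ?natr1 ?pnatr_eq0 -?lt0n ?fact_gt0 //=.
rewrite {1}/bes; apply/cvg_lim => //.
rewrite -cvg_shiftS /=; under eq_fun do rewrite H.
apply: cvgB; apply: cvgMr.
  by rewrite (cvg_shiftS (pseries (bescoef n.+1) z)); exact: is_cvg_bes.
exact: is_cvg_bes.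
Qed.

End BesselSeries.

(** * The first positive zero of J_1 *)

Section BesselPositivity.
Variable R : realType.
Implicit Types (n m : nat) (z x a b : R).

Lemma MVT_global (f f' : R -> R) a b : (forall x, is_derive x 1 f (f' x)) ->
  a < b -> exists2 c, a < c < b & f b - f a = f' c * (b - a).
Proof.
move=> df ab.
have cf : {within `[a, b], continuous f}.
  apply: continuous_subspaceT => x; apply: differentiable_continuous.
  by apply/derivable1_diffP; have [] := df x.
have [c] := MVT ab (fun x _ => df x) cf.
by rewrite in_itv /= => ? ?; exists c.
Qed.

(** Iterating this carries the positivity of a third derivative down to the function itself. *)
Lemma gt0_from_derive (f f' : R -> R) b : (forall x, is_derive x 1 f (f' x)) ->
  f 0 = 0 -> (forall x, 0 < x <= b -> 0 < f' x) -> forall x, 0 < x <= b -> 0 < f x.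
Proof.
move=> df f0 f'0 x /andP[x0 xb].
have [c /andP[c0 cx]] := MVT_global df x0.
rewrite f0 !subr0 => ->; rewrite mulr_gt0// f'0// c0/=; lra.
Qed.

Lemma near_gt (f : R -> R) x (y : R) : {for x, continuous f} -> y < f x ->
  exists2 e, 0 < e & forall t, `|t - x| <= e -> y < f t.
Proof.
move=> cf yfx; have : \forall t \near x, y < f t.
  exact: cvgr_gt cf _ yfx.
move=> /nbhs_ballP[e /= e0 H]; exists (e / 2); first by rewrite divr_gt0.
move=> t tx; apply: H; rewrite /ball /= distrC; apply: le_lt_trans tx _; lra.
Qed.

Lemma besselJ1E x : besselJ 1 x = x / 2 * bes 1 (x ^+ 2 / 4).
Proof.
rewrite /besselJ /bes; apply/cvg_lim => //.
rewrite (_ : series _ = fun N => x / 2 * pseries (bescoef R 1) (x ^+ 2 / 4) N).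
  by apply: cvgMl_tmp; exact: is_cvg_bes.
apply/funext => N; rewrite /pseries /series /= mulr_sumr.
apply: eq_bigr => m _; rewrite /bescoef exprD expr1 exprM.
have -> : (x / 2) ^+ 2 = x ^+ 2 / 4 by field.
ring.
Qed.

Lemma bes0 n : bes n 0 = n`!%:R^-1 :> R.
Proof.
apply/cvg_lim => //; rewrite -cvg_shiftS /=.
apply: cvg_near_cst; apply: nearW => N.
rewrite /pseries /series /= big_nat_recl//= big1 ?addr0 => [|i _].
  by rewrite /bescoef expr0 mulr1 fact0 mul1n div1r.
by rewrite expr0n /= mulr0.
Qed.

(** Together with the value 1 at 0 this brackets a zero of [bes 1] in [0, 4]. In the negated series,
    the first five terms have a positive sum and the later ones are grouped in positive pairs. *)
Lemma bes1_4_lt0 : bes 1 4 < 0 :> R.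
Proof.
rewrite -oppr_gt0 /bes -limN; last exact: is_cvg_bes.
rewrite -pseriesN; set g := fun i => (- bescoef R 1) i * 4 ^+ i.
have -> : pseries (- bescoef R 1) 4 = series g by [].
(* The first five terms add up to 1/45. *)
apply: lt_trans (@lt_sum_lim_series R g 5 _ _).
- rewrite /g !big_nat_recr//= big_nil !fctE /bescoef !addn1 !factS fact0 !exprS !expr0.
  rewrite !natrM; lra.
- have -> : series g = pseries (- bescoef R 1) 4 by [].
  by rewrite pseriesN; apply: is_cvgN; exact: is_cvg_bes.
- move=> d; rewrite /g !fctE /bescoef (addnS 5).
  have oM : odd (5 + d.*2) by rewrite oddD odd_double.
  have M0 : (5 : R) <= (5 + d.*2)%:R by rewrite ler_nat leq_addr.
  move: (5 + d.*2)%N oM M0 => M oM M0.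
  rewrite !addn1 [(-1) ^+ M.+1]exprS -signr_odd oM expr1 !factS !natrM exprS.
  set P := M`!%:R : R; have P0 : 0 < P by rewrite ltr0n fact_gt0.
  set W := (4 : R) ^+ M; have W0 : 0 < W by rewrite exprn_gt0.
  rewrite -[M.+2%:R]natr1 -[M.+1%:R]natr1; set u := M%:R in M0 *.
  (* For odd [M] the term of index [M] is positive, and the next one is smaller in absolute value by
     the factor 4 / ((M + 1) (M + 2)) < 1. *)
  have -> : - (-1 / (P * ((u + 1) * P))) * W +
    - (-1 * -1 / ((u + 1) * P * ((u + 1 + 1) * ((u + 1) * P)))) * (4 * W)
    = W / (P * P * (u + 1)) * (1 - 4 / ((u + 1) * (u + 2))).
    field; rewrite (gt_eqF P0)/=; apply/andP; split; lra.
  rewrite mulr_gt0 ?divr_gt0 ?mulr_gt0//; first lra.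
  rewrite subr_gt0 ltr_pdivrMr ?mul1r; nra.
Qed.

Let z0 : R := j11 R ^+ 2 / 4.

(** [j11] is only an infimum, so three facts are needed: the set of zeros is nonempty, it stays away
    from 0, and by continuity the infimum is itself a zero. *)
Lemma j11_spec : [/\ 0 < j11 R, bes 1 z0 = 0
  & forall z, 0 <= z < z0 -> 0 < bes 1 z].
Proof.
set S := [set x : R | 0 < x /\ besselJ 1 x = 0].
have SE x : 0 < x -> S x <-> bes 1 (x ^+ 2 / 4) = 0.
  move=> x0; rewrite /S /= besselJ1E; split => [[_ /eqP]|->]; last by rewrite mulr0.
  by rewrite mulf_eq0 => /orP[/eqP|/eqP//]; lra.
have c1 : continuous (@bes R 1) by exact: continuous_bes.
have [w] : exists2 w : R, w \in `[0, 4]%R & bes 1 w = 0.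
  apply: (@IVT R (@bes R 1) 0 4 0) => //.
    exact: continuous_subspaceT.
  rewrite bes0 invr1 minElt maxElt.
  have b4 := bes1_4_lt0; case: ltP => ?; apply/andP; split; lra.
rewrite in_itv /= => /andP[wi _] bw.
have w0 : 0 < w.
  rewrite lt_neqAle wi andbT; apply/eqP => e; move: bw; rewrite -e bes0 invr1.
  by move/eqP; rewrite oner_eq0.
have Sn0 : S !=set0.
  exists (2 * Num.sqrt w); apply/SE; first by rewrite mulr_gt0 ?sqrtr_gt0.
  rewrite exprMn sqr_sqrtr ?(ltW w0)// -bw; congr (bes 1 _); lra.
have lbS : has_lbound S by exists 0 => x [/ltW].
have hi : has_inf S by split.
have [e e0 He] : exists2 e : R, 0 < e & forall t, `|t - 0| <= e -> 0 < bes 1 t.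
  by apply: near_gt; [exact: c1|rewrite bes0 invr1].
have j0 : 0 < j11 R.
  apply: (@lt_le_trans _ _ (Num.sqrt e)); first by rewrite sqrtr_gt0.
  apply: lb_le_inf => // x Sx; have x0 : 0 < x by case: Sx.
  rewrite leNgt; apply/negP => xe.
  move/(SE _ x0): Sx => Sx; suff : 0 < bes 1 (x ^+ 2 / 4) by rewrite Sx ltxx.
  have xe2 : x ^+ 2 < e.
    by rewrite -(@sqr_sqrtr _ e) ?(ltW e0)// ltr_pXn2r// ?nnegrE ?sqrtr_ge0// ltW.
  apply: He; rewrite subr0 ger0_norm ?divr_ge0 ?sqr_ge0//; nra.
(* A value that is not positive would give, by the intermediate value theorem from [bes 1 0 = 1], a
   zero below the infimum. *)
have pos z : 0 <= z < z0 -> 0 < bes 1 z.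
  move=> /andP[zge0 zz]; rewrite ltNge; apply/negP => bz.
  have [v] : exists2 v : R, v \in `[0, z]%R & bes 1 v = 0.
    apply: (@IVT R (@bes R 1) 0 z 0) => //.
      exact: continuous_subspaceT.
    rewrite bes0 invr1 minElt maxElt; case: ltP => ?; apply/andP; split; lra.
  rewrite in_itv /= => /andP[vi vz] bv.
  have v0 : 0 < v.
    rewrite lt_neqAle vi andbT; apply/eqP => e'; move: bv; rewrite -e' bes0 invr1.
    by move/eqP; rewrite oner_eq0.
  have : S (2 * Num.sqrt v).
    apply/SE; first by rewrite mulr_gt0 ?sqrtr_gt0.
    rewrite exprMn sqr_sqrtr ?(ltW v0)// -bv; congr (bes 1 _); lra.
  move=> /(ge_inf lbS); rewrite -/(j11 R) => /(lerXn2r 2) H.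
  have := H _ _; rewrite !nnegrE exprMn sqr_sqrtr ?(ltW v0)// => H'.
  have := H' (ltW j0) _; rewrite mulr_ge0 ?sqrtr_ge0// => /(_ isT).
  move: zz; rewrite /z0; lra.
split=> //; apply/eqP; rewrite eq_le; apply/andP; split; rewrite leNgt; apply/negP => bz.
(* A positive value at [z0] would leave a neighbourhood of [j11 R] without zeros, against the
   infimum being adherent to the zeros. *)
- have cs : {for j11 R, continuous (fun x : R => bes 1 (x ^+ 2 / 4))}.
    apply: (@continuous_comp _ _ _ (fun x : R => x ^+ 2 / 4) (bes 1)); last exact: c1.
    by apply: cvgM; [exact: exprn_continuous|exact: cvg_cst].
  have [f f0 Hf] := near_gt cs bz.
  have [x Sx xj] := @inf_adherent _ S f f0 hi.
  have jx : j11 R <= x by apply: ge_inf.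
  have x0 : 0 < x by lra.
  move/(SE _ x0): Sx => Sx; have := Hf x; rewrite Sx ltxx.
  move=> /(_ _)/negP; apply; last by [].
  by rewrite ger0_norm ?subr_ge0//; rewrite -/(j11 R) in xj; lra.
(* A negative value at [z0] would persist slightly to the left, where positivity is known; [t] is
   cut off at 0 to stay in that range. *)
- have [d d0 Hd] : exists2 d : R, 0 < d & forall t, `|t - z0| <= d -> 0 < - bes 1 t.
    apply: (@near_gt (fun t => - bes 1 t)); last by rewrite oppr_gt0.
    by apply: continuousN; exact: c1.
  have zp : 0 < z0 by rewrite divr_gt0// exprn_gt0.
  pose t := Num.max 0 (z0 - d).
  have t0 : 0 <= t by rewrite /t le_max lexx.
  have tz : t < z0 by rewrite /t gt_max zp/= ltrBlDr ltrDl.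
  have td : z0 - d <= t by rewrite /t le_max lexx orbT.
  have := pos t; rewrite t0 tz => /(_ isT).
  have := Hd t; rewrite ler0_norm ?subr_le0 ?(ltW tz)// => /(_ _).
  lra.
Qed.

End BesselPositivity.

(** * Averaging over two radii *)

Section Perturbation.
Variable R : realType.
Implicit Types (n : nat) (z x a b : R).

Section DeriveLambda.
Variables (f g : R -> R) (x df dg : R).
Hypotheses (Df : is_derive x 1 f df) (Dg : is_derive x 1 g dg).

(** These rules act on explicit functions, with products in place of scalings, so that derivatives
    of compound formulas are assembled as terms and then simplified by [ring]. *)
Lemma is_derive_addf : is_derive x 1 (fun t => f t + g t) (df + dg).
Proof. exact: is_deriveD. Qed.

Lemma is_derive_subf : is_derive x 1 (fun t => f t - g t) (df - dg).
Proof. exact: is_deriveB. Qed.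

Lemma is_derive_mulf : is_derive x 1 (fun t => f t * g t) (f x * dg + df * g x).
Proof. by rewrite [df * _]mulrC; exact: is_deriveM. Qed.

Lemma is_derive_cmulf c : is_derive x 1 (fun t => c * f t) (c * df).
Proof. exact: is_deriveZ. Qed.

End DeriveLambda.

Lemma is_derive_affine (k c x : R) : is_derive x 1 (fun t => k + c * t) c.
Proof.
by apply: is_derive_eq; rewrite add0r mul1r [LHS]mulr1.
Qed.

Lemma is_derive_bes_affine n (k c x : R) :
  is_derive x 1 (fun x => bes n (k + c * x)) (- c * bes n.+1 (k + c * x)).
Proof.
have := @is_derive1_comp R (@bes R n) (fun x => k + c * x) x (- bes n.+1 (k + c * x)) c
  (is_derive_bes _ _) (is_derive_affine _ _ _).
by rewrite mulNr -mulrN mulrC.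
Qed.

Let z0 : R := j11 R ^+ 2 / 4.

Lemma z0_gt0 : 0 < z0.
Proof. by have [j0 _ _] := j11_spec R; rewrite divr_gt0// exprn_gt0. Qed.

(** By the recurrence, z^2 [bes 2 z] has derivative z [bes 1 z], which is positive before [z0]. At
    [z0] this amounts to J_2(j_{1,1}) > 0. *)
Lemma bes2_gt0 z : 0 <= z <= z0 -> 0 < bes 2 z.
Proof.
have [_ b0 bp] := j11_spec R; rewrite -/z0 in b0 bp.
move=> /andP[]; rewrite le_eqVlt => /predU1P[<- _|zgt0 zle].
  by rewrite bes0 invr_gt0 ltr0n.
have D (x : R) : is_derive x 1 (fun x : R => x ^+ 2 * bes 2 x) (x * bes 1 x).
  apply: is_derive_eq.
    by apply: is_derive_mulf; exact: is_derive_bes.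
  rewrite (bes_rec 1 x) ![_%:A]mulr1; ring.
suff : 0 < z ^+ 2 * bes 2 z by rewrite pmulr_rgt0// exprn_gt0.
have [c /andP[c0 cz]] := MVT_global D zgt0.
rewrite expr0n mul0r !subr0 => ->; rewrite !mulr_gt0// bp// (ltW c0)/=; lra.
Qed.

(* With [z = |xi| ^+ 2 / 4], this is [4 / pi] times the combination with weights
   3/4 and 1/4 of the transforms at [xi] of the disks of squared radii [1 - b]
   and [1 + 3 * b]. *)
Definition two_radii b z : R :=
  3 * ((1 - b) * bes 1 (z * (1 - b))) + (1 + 3 * b) * bes 1 (z * (1 + 3 * b)).

Lemma two_radii_gt0 : exists2 b1 : R, 0 < b1 &
  forall b, 0 < b <= b1 -> 0 < two_radii b z0.
Proof.
have [_ b0 bp] := j11_spec R; rewrite -/z0 in b0 bp; have zp := z0_gt0.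
(* [q1], [q2], [q3] are the successive derivatives in [b] of the function [q] below. The form of
   [q1] is short because u [bes 1 (z0 * u)] has derivative [bes 0 (z0 * u)] in u, by [bes_rec 0]. *)
pose q3 b := 3 * z0 ^+ 2 * (9 * bes 2 (z0 + 3 * z0 * b) - bes 2 (z0 + - z0 * b)).
pose q2 b := - 3 * z0 * (3 * bes 1 (z0 + 3 * z0 * b) + bes 1 (z0 + - z0 * b)).
pose q1 b := 3 * (bes 0 (z0 + 3 * z0 * b) - bes 0 (z0 + - z0 * b)).
have Bd n c x := is_derive_bes_affine n z0 c x.
have Dq2 x : is_derive x 1 q2 (q3 x).
  have D := is_derive_cmulf (is_derive_addf
    (is_derive_cmulf (Bd 1%N (3 * z0) x) 3) (Bd 1%N (- z0) x)) (- 3 * z0).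
  by apply: (is_derive_eq D); rewrite /q3; ring.
have Dq1 x : is_derive x 1 q1 (q2 x).
  have D := is_derive_cmulf (is_derive_subf (Bd 0%N (3 * z0) x) (Bd 0%N (- z0) x)) 3.
  by apply: (is_derive_eq D); rewrite /q2; ring.
pose q b := 3 * ((1 - b) * bes 1 (z0 + - z0 * b)) + (1 + 3 * b) * bes 1 (z0 + 3 * z0 * b).
have Dq x : is_derive x 1 q (q1 x).
  have D1 : is_derive x 1 (fun b : R => 1 - b) (0 - 1) by exact: is_derive_subf.
  have D := is_derive_addf
    (is_derive_cmulf (is_derive_mulf D1 (Bd 1%N (- z0) x)) 3)
    (is_derive_mulf (is_derive_affine 1 3 x) (Bd 1%N (3 * z0) x)).
  by apply: (is_derive_eq D); rewrite /q1 !(bes_rec 0); ring.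
have c3 : {for 0, continuous q3}.
  apply: differentiable_continuous; apply/derivable1_diffP.
  rewrite /q3; apply: derivableZ; apply: derivableB; last by have [] := Bd 2 (- z0) 0.
  by apply: derivableZ; have [] := Bd 2 (3 * z0) 0.
(* The value of [q3] at 0 is 24 z0^2 [bes 2 z0]. *)
have q30 : 0 < q3 0.
  rewrite /q3 !mulr0 addr0; have := @bes2_gt0 z0; rewrite lexx (ltW zp) => /(_ isT) ?.
  by rewrite mulr_gt0 ?subr_gt0 ?(mulr_gt0 _ (exprn_gt0 2 zp))//; lra.
have [b1 b10 Hb] := near_gt c3 q30.
exists b1 => // b bb.
have -> : two_radii b z0 = q b.
  rewrite /two_radii /q; congr (3 * (_ * bes 1 _) + _ * bes 1 _); ring.
have H3 x : 0 < x <= b1 -> 0 < q3 x.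
  by move=> /andP[x0 xb]; apply: Hb; rewrite subr0 gtr0_norm.
(* Three integrations from 0 follow. The initial values of [q2] and [q] vanish because
   [bes 1 z0 = 0], that of [q1] because its two terms cancel. *)
have H2 := gt0_from_derive Dq2 _ H3.
have {}H2 : forall x, 0 < x <= b1 -> 0 < q2 x.
  by apply: H2; rewrite /q2 !mulr0 addr0 b0 mulr0 addr0 mulr0.
have {H2} H1 : forall x, 0 < x <= b1 -> 0 < q1 x.
  by apply: gt0_from_derive Dq1 _ H2; rewrite /q1 !mulr0 addr0 subrr mulr0.
apply: (gt0_from_derive Dq _ H1) => //.
by rewrite /q !mulr0 addr0 b0 !mulr0 addr0.
Qed.

(** [bes 1] decreases as long as [bes 2] is positive, hence slightly beyond [z0]. So [two_radii b]
    decreases in z there, and a lower bound at the right endpoint, near [z0], serves the whole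
    interval. *)
Lemma two_radii_bounded_below (beta : R) : 0 < beta ->
  exists b eta c : R, [/\ 0 < b < beta, b < 1, 0 < eta, 0 < c &
    forall z, 0 <= z <= z0 + eta -> c <= two_radii b z].
Proof.
move=> beta0; have [b1 b10 Hb] := two_radii_gt0; have zp := z0_gt0.
have c2 : {for z0, continuous (@bes R 2)} by exact: continuous_bes.
have b2 : 0 < bes 2 z0 by apply: bes2_gt0; rewrite lexx ltW.
have [e e0 He] := near_gt c2 b2.
have pos2 z : 0 <= z <= z0 + e -> 0 < bes 2 z.
  move=> /andP[zge0 zle]; have [zz|zz] := leP z z0; first by apply: bes2_gt0; rewrite zge0.
  by apply: He; rewrite gtr0_norm ?subr_gt0//; lra.
have anti x y : 0 <= x -> x <= y -> y <= z0 + e -> bes 1 y <= bes 1 x.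
  move=> x0; rewrite le_eqVlt => /predU1P[->//|xy] yz.
  have [c /andP[xc cy] H] := MVT_global (fun z => is_derive_bes 1 z) xy.
  rewrite -subr_le0 H mulNr oppr_le0 mulr_ge0//; last by rewrite subr_ge0 ltW.
  apply/ltW/pos2; apply/andP; split; lra.
(* With b <= 1/2, 3 b z0 <= e/2 and, later, eta <= e/5, one gets (z0 + eta) (1 + 3b) <= z0 + e, so
   both arguments of [bes 1] stay where it decreases. *)
pose b := Num.min (Num.min b1 (beta / 2)) (Num.min (1 / 2) (e / (6 * z0))).
have bP : [/\ 0 < b, b <= b1, b <= beta / 2, b <= 1 / 2 & b <= e / (6 * z0)].
  rewrite /b !lt_min !ge_min !lexx ?orbT b10 /=; split => //.
  by rewrite !divr_gt0// mulr_gt0.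
case: bP => bp bb1 bbeta bh; rewrite ler_pdivlMr; last by rewrite mulr_gt0.
move=> be.
have qp : 0 < two_radii b z0 by apply: Hb; rewrite bp.
have cq : {for z0, continuous (two_radii b)}.
  have D c := is_derive_bes_affine 1 0 c z0.
  apply: differentiable_continuous; apply/derivable1_diffP.
  have -> : two_radii b = (fun z => 3 * ((1 - b) * bes 1 (0 + (1 - b) * z)) +
      (1 + 3 * b) * bes 1 (0 + (1 + 3 * b) * z)).
    by apply/funext => z; rewrite /two_radii !add0r ![_ * z]mulrC.
  apply: derivableD.
    by do 2 apply: derivableZ; have [] := D (1 - b).
  by apply: derivableZ; have [] := D (1 + 3 * b).
have qh : two_radii b z0 / 2 < two_radii b z0 by lra.
have [f f0 Hf] := near_gt cq qh.
pose eta := Num.min f (e / 5).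
have [eta0 ef e5] : [/\ 0 < eta, eta <= f & eta <= e / 5].
  by rewrite /eta lt_min !ge_min !lexx orbT f0 divr_gt0.
exists b, eta, (two_radii b z0 / 2); split => //.
- apply/andP; split => //; lra.
- lra.
- by rewrite divr_gt0.
move=> z /andP[zge0 zle].
apply: (@le_trans _ _ (two_radii b (z0 + eta))).
  by apply/ltW/Hf; rewrite addrC addKr gtr0_norm.
apply: lerD.
  rewrite ler_wpM2l// ler_wpM2l//; first by lra.
  apply: anti; [apply: mulr_ge0 => //; lra | apply: ler_wpM2r => //; lra | nra].
rewrite ler_wpM2l//; first by lra.
apply: anti; [apply: mulr_ge0 => //; lra | apply: ler_wpM2r => //; lra | nra].
Qed.

End Perturbation.

(** * Rotation invariance of the area *)

Section Rotation.
Variable R : realType.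
Notation leb := (@lebesgue_measure R).
Notation RR := (measurableTypeR R * measurableTypeR R)%type.

Lemma measurable_translation (k : R) :
  measurable_fun setT (fun y : measurableTypeR R => (y + k : measurableTypeR R)).
Proof. exact: measurable_funD. Qed.

(** Lebesgue measure is determined by its values on intervals, and translation keeps their
    lengths. *)
Lemma lebesgue_translation (k : R) (A : set (measurableTypeR R)) : measurable A ->
  leb ((fun y : R => y + k) @^-1` A) = leb A.
Proof.
move=> mA.
suff : leb A = pushforward leb (fun y : measurableTypeR R => (y + k : measurableTypeR R)) A.
  by move=> ->.
apply: lebesgue_measure_unique => //.
  exact: measurable_translation.
move=> mt _ [[a b] _ <-].
transitivity (leb `]a - k, b - k]%classic); last first.
  congr (leb _).
  by apply/seteqP; split => y /=; rewrite !in_itv/= ltrBlDr lerBrDr.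
by rewrite !lebesgue_measure_itv/= !lte_fin ltrD2r -!EFinB opprB addrA subrK.
Qed.

Definition shearx (k : R) (z : RR) : RR := (z.1 + k * z.2, z.2).
Definition sheary (k : R) (z : RR) : RR := (z.1, z.2 + k * z.1).

Lemma measurable_shearx k : measurable_fun setT (shearx k).
Proof.
apply: measurable_fun_pair => //.
by apply: measurable_funD => //; apply: measurable_funM.
Qed.

Lemma measurable_sheary k : measurable_fun setT (sheary k).
Proof.
apply: measurable_fun_pair => //.
by apply: measurable_funD => //; apply: measurable_funM.
Qed.

(** On each vertical line the shear is a translation, by [k * x]. *)
Lemma vol2_sheary k (A : set RR) : measurable A -> vol2 R (sheary k @^-1` A) = vol2 R A.
Proof.
move=> mA; rewrite /vol2 /= /product_measure1; apply: eq_integral => x _ /=.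
have mxA : measurable (xsection A x) by exact: measurable_xsection.
by rewrite -(lebesgue_translation (k * x) mxA).
Qed.

(** Computing the area by horizontal sections instead makes the other shear a translation on each
    section. *)
Lemma vol2_product_measure2 (A : set RR) : measurable A ->
  vol2 R A = (leb \x^ leb)%E A.
Proof.
move=> mA; apply: product_measure_unique => // B C mB mC /=.
by rewrite product_measure2E.
Qed.

Lemma vol2_shearx k (A : set RR) : measurable A -> vol2 R (shearx k @^-1` A) = vol2 R A.
Proof.
move=> mA; rewrite !vol2_product_measure2//; last first.
  by rewrite -[X in measurable X]setTI; exact: measurable_shearx.
rewrite /product_measure2; apply: eq_integral => y _ /=.
have myA : measurable (ysection A y) by exact: measurable_ysection.
by rewrite -(lebesgue_translation (k * y) myA).
Qed.

(* Multiplication by [c + i s]. *)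
Definition rotation (c s : R) (z : RR) : RR := (c * z.1 - s * z.2, s * z.1 + c * z.2).

Lemma measurable_rotation c s : measurable_fun setT (rotation c s).
Proof.
apply: measurable_fun_pair.
  by apply: measurable_funB => //; apply: measurable_funM.
by apply: measurable_funD => //; apply: measurable_funM.
Qed.

(* Shears preserve the area by Fubini and translation invariance. *)
Lemma rotation_shears c s : s != 0 -> c ^+ 2 + s ^+ 2 = 1 ->
  rotation c s = shearx ((c - 1) / s) \o sheary s \o shearx ((c - 1) / s).
Proof.
move=> s0 cs; apply/funext => -[x y]; rewrite /rotation /shearx /sheary /=.
have e : s * s = 1 - c * c by rewrite -cs; ring.
congr (_, _); last by field.
have -> : - (s * y) = - (s * s) / s * y by field.
by rewrite e; field.
Qed.

Lemma vol2_rotation c s (A : set RR) : c ^+ 2 + s ^+ 2 = 1 -> measurable A ->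
  vol2 R (rotation c s @^-1` A) = vol2 R A.
Proof.
have main c' s' (B : set RR) : s' != 0 -> c' ^+ 2 + s' ^+ 2 = 1 -> measurable B ->
    vol2 R (rotation c' s' @^-1` B) = vol2 R B.
  move=> s0 cs mB; rewrite rotation_shears// !comp_preimage.
  have m1 : measurable (shearx ((c' - 1) / s') @^-1` B).
    by rewrite -[X in measurable X]setTI; exact: measurable_shearx.
  have m2 : measurable (sheary s' @^-1` (shearx ((c' - 1) / s') @^-1` B)).
    by rewrite -[X in measurable X]setTI; exact: measurable_sheary.
  by rewrite vol2_shearx// vol2_sheary// vol2_shearx.
move=> cs mA; have [s0|] := eqVneq s 0; last by move=> s0; exact: main.
have c0 : c != 0.
  by apply/eqP => c0; move: cs; rewrite c0 s0 !expr0n addr0 => /eqP; rewrite eq_sym oner_eq0.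
(* A half turn is two quarter turns. *)
have -> : rotation c s = rotation 0 1 \o rotation 0 (- c).
  by apply/funext => -[x y]; rewrite /rotation s0 /=; congr (_, _); ring.
rewrite comp_preimage.
have m1 : measurable (rotation 0 1 @^-1` A).
  by rewrite -[X in measurable X]setTI; exact: measurable_rotation.
transitivity (vol2 R (rotation 0 1 @^-1` A)); apply: main => //.
- by rewrite oppr_eq0.
- by move: cs; rewrite s0 sqrrN expr0n addr0 add0r.
- by rewrite expr0n add0r expr1n.
Qed.

End Rotation.

(** * The transform of a disk *)

Section Poisson.
Variable R : realType.
Notation leb := (@lebesgue_measure R).
Implicit Types (x t u : R) (m : nat).
Let h : R := pi / 2.

Lemma FTC2_global (F f : R -> R) (a b : R) : a < b ->
  (forall x, is_derive x 1 F (f x)) -> continuous f ->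
  \int[leb]_(x in `[a, b]) f x = F b - F a.
Proof.
move=> ab DF cf.
have cF : continuous F.
  by move=> x; apply: differentiable_continuous; apply/derivable1_diffP; have [] := DF x.
rewrite /Rintegral (@continuous_FTC2 _ f F)//.
- exact: continuous_subspaceT.
- split.
  + by move=> x _; have [] := DF x.
  + by apply: cvg_at_right_filter; exact: cF.
  + by apply: cvg_at_left_filter; exact: cF.
- by move=> x _; rewrite derive1E; have [] := DF x.
Qed.

Lemma continuous_integrable (f : R -> R) (a b : R) : continuous f ->
  leb.-integrable `[a, b] (EFin \o f).
Proof.
move=> cf; apply: continuous_compact_integrable; first exact: segment_compact.
exact: continuous_subspaceT.
Qed.

(** Wallis-type integrals, which arise when cos (u sin x) is expanded in powers of u. *)
Definition moment (m : nat) : R :=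
  \int[leb]_(x in `[- h, h]) (sin x ^+ (2 * m) * cos x ^+ 2).

Lemma h_gt0 : - h < h.
Proof. by rewrite /h gtrN// divr_gt0// pi_gt0. Qed.

Lemma continuous_sinXcos2 m :
  continuous (fun x : R => sin x ^+ m * cos x ^+ 2).
Proof.
move=> x; apply: cvgM.
  by apply: (@continuous_comp _ _ _ sin (fun y => y ^+ m));
    [exact: continuous_sin|exact: exprn_continuous].
by apply: (@continuous_comp _ _ _ cos (fun y => y ^+ 2));
    [exact: continuous_cos|exact: exprn_continuous].
Qed.

Lemma moment0 : moment 0 = pi / 2.
Proof.
pose F x : R := 2^-1 * (x + sin x * cos x).
have DF x : is_derive x 1 F (sin x ^+ 0 * cos x ^+ 2).
  have D := is_derive_cmulf (is_derive_addf (is_derive_id x 1)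
    (is_derive_mulf (is_derive_sin x) (is_derive_cos x))) 2^-1.
  apply: (is_derive_eq D); rewrite expr0 mul1r.
  transitivity (2^-1 * (1 + cos x ^+ 2 - sin x ^+ 2)); first by ring.
  by rewrite sin2cos2; field.
rewrite /moment muln0 (FTC2_global h_gt0 DF); last exact: continuous_sinXcos2.
by rewrite /F sinN cosN cos_pihalf !mulr0 !addr0 /h; field.
Qed.

Lemma is_derive_powf (f : R -> R) x (df : R) n : is_derive x 1 f df ->
  is_derive x 1 (fun t => f t ^+ n.+1) (n.+1%:R * f x ^+ n * df).
Proof.
move=> Df; have -> : (fun t => f t ^+ n.+1) = f ^+ n.+1.
  by apply/funext => t; rewrite exprfctE.
by apply: (is_derive_eq (is_deriveX n.+1 Df)).
Qed.

(** The derivative of sin^(2m+1) cos^3 is the difference of the two integrands, and this primitive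
    vanishes at both endpoints. *)
Lemma momentS m : (2 * m%:R + 4) * moment m.+1 = (2 * m%:R + 1) * moment m.
Proof.
pose f x : R := (2 * m%:R + 1) * (sin x ^+ (2 * m) * cos x ^+ 2)
  - (2 * m%:R + 4) * (sin x ^+ (2 * m.+1) * cos x ^+ 2).
pose F x : R := sin x ^+ (2 * m).+1 * cos x ^+ 3.
have DF x : is_derive x 1 F (f x).
  have D := is_derive_mulf (is_derive_powf (2 * m) (is_derive_sin x))
    (is_derive_powf 2 (is_derive_cos x)).
  apply: (is_derive_eq D); rewrite /f /GRing.scale /= mulnS !exprS !expr0.
  have -> : (2 * m).+1%:R = 2 * m%:R + 1 :> R by rewrite -natr1 natrM.
  have e : 1 - sin x * sin x = cos x * cos x.
    by rewrite -(cos2Dsin2 x) !expr2; ring.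
  set p := sin x ^+ (2 * m).
  transitivity (((2 * m%:R + 1) * p * (cos x * cos x) * (1 - sin x * sin x))
     - 3 * (sin x * sin x) * p * cos x * cos x); last by ring.
  by rewrite e; ring.
have c n : continuous (fun x : R => n * (sin x ^+ (2 * m) * cos x ^+ 2)).
  by move=> x; apply: cvgMl_tmp; exact: continuous_sinXcos2.
have c' n : continuous (fun x : R => n * (sin x ^+ (2 * m.+1) * cos x ^+ 2)).
  by move=> x; apply: cvgMl_tmp; exact: continuous_sinXcos2.
have cf : continuous f by move=> x; apply: cvgB; [exact: c|exact: c'].
have := FTC2_global h_gt0 DF cf.
rewrite /F cosN cos_pihalf !expr0n !mulr0 subrr /f RintegralB//; last 2 first.
- exact: continuous_integrable.
- exact: continuous_integrable.
rewrite !RintegralZl//; last 2 first.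
- by apply: continuous_integrable; exact: continuous_sinXcos2.
- by apply: continuous_integrable; exact: continuous_sinXcos2.
by move=> /eqP; rewrite subr_eq0 => /eqP <-.
Qed.

Lemma momentE m : moment m = pi / 2 * (2 * m)`!%:R / (4 ^+ m * (m`! * m.+1`!)%:R).
Proof.
elim: m => [|m IH]; first by rewrite moment0 muln0 fact0 expr0 !mulr1 invr1 mulr1.
have m0 : (2 * m%:R + 4 : R) != 0 by rewrite gt_eqF// addr_gt0// ltr_wpDl.
apply: (mulfI m0); rewrite momentS IH mulnS !add2n !factS !natrM !exprS -!natr1.
rewrite !natrM.
by field; rewrite !natr1 expf_neq0 ?fact_neq0 ?pnatr_eq0.
Qed.

(** Poisson's formula J_1(u) = (u / pi) times this integral. The cosine series is integrated term by
    term, by dominated convergence, and the moments reproduce the coefficients of [bes 1]. *)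
Lemma poisson_integral (u : R) :
  \int[leb]_(x in `[- h, h]) (cos (u * sin x) * cos x ^+ 2) = h * bes 1 (u ^+ 2 / 4).
Proof.
pose T m x : R := cos_coeff' (u * sin x) m * cos x ^+ 2.
have TE m x :
    T m x = (-1) ^+ m * u ^+ (2 * m) / (2 * m)`!%:R * (sin x ^+ (2 * m) * cos x ^+ 2).
  by rewrite /T /cos_coeff' -exprnP -mul2n exprMn; ring.
have cT m : continuous (T m).
  have -> : T m = fun x =>
      (-1) ^+ m * u ^+ (2 * m) / (2 * m)`!%:R * (sin x ^+ (2 * m) * cos x ^+ 2).
    by apply/funext => x; rewrite TE.
  by move=> x; apply: cvgMl_tmp; exact: continuous_sinXcos2.
have cS N : continuous (fun x => \sum_(0 <= m < N) T m x).
  elim: N => [|N IH] x.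
    by under eq_fun do rewrite big_nil; exact: cvg_cst.
  under eq_fun do rewrite big_nat_recr//=.
  by apply: cvgD; [exact: IH|exact: cT].
have IT m : \int[leb]_(x in `[- h, h]) T m x = h * (bescoef R 1 m * (u ^+ 2 / 4) ^+ m).
  under eq_Rintegral do rewrite TE.
  rewrite RintegralZl//; last by apply: continuous_integrable; exact: continuous_sinXcos2.
  rewrite -/(moment m) momentE /bescoef addn1 natrM expr_div_n -exprM /h.
  by field; rewrite expf_neq0 ?fact_neq0.
have IS N : \int[leb]_(x in `[- h, h]) (\sum_(0 <= m < N) T m x) =
    h * pseries (bescoef R 1) (u ^+ 2 / 4) N.
  elim: N => [|N IH].
    rewrite /pseries /series /= big_nil mulr0.
    under eq_Rintegral do rewrite big_nil.
    by rewrite Rintegral_cst// mul0r.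
  under eq_Rintegral do rewrite big_nat_recr//=.
  rewrite RintegralD//; [|exact: continuous_integrable..].
  by rewrite IH IT /pseries /series /= big_nat_recr//= mulrDr.
(* Since (2m)! >= m!, the partial sums are dominated by the exponential series at u^2, which gives a
   constant dominating function. *)
have bnd N x : `|\sum_(0 <= m < N) T m x| <= expR (u ^+ 2).
  apply: (le_trans (ler_norm_sum _ _ _)).
  apply: (@le_trans _ _ (series (exp_coeff (u ^+ 2)) N)).
    rewrite /series /=; apply: ler_sum => m _.
    rewrite TE !normrM !normrX normrN1 expr1n mul1r normfV normr_nat.
    have s1 : `|sin x| ^+ (2 * m) * `|cos x| ^+ 2 <= 1.
      by rewrite mulr_ile1 ?exprn_ge0// exprn_ile1// ?sin_max ?cos_max.
    rewrite /exp_coeff /= (exprM _ 2 m) -normrX ger0_norm ?sqr_ge0//.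
    apply: (@le_trans _ _ ((u ^+ 2) ^+ m / (2 * m)`!%:R)).
      by rewrite ler_piMr// divr_ge0// exprn_ge0// sqr_ge0.
    rewrite ler_wpM2l//; first by rewrite exprn_ge0// sqr_ge0.
    rewrite lef_pV2 ?posrE ?ltr0n ?fact_gt0//.
    by rewrite ler_nat leq_fact// leq_pmull.
  rewrite /expR; apply: nondecreasing_cvgn_le; last exact: is_cvg_series_exp_coeff.
  apply: nondecreasing_series => m _ _.
  by rewrite /exp_coeff /= divr_ge0// exprn_ge0// sqr_ge0.
have mI : measurable (`[- h, h] : set (measurableTypeR R)) by exact: measurable_itv.
have cf : continuous (fun x : R => cos (u * sin x) * cos x ^+ 2).
  move=> x; apply: cvgM.
    apply: (@continuous_comp _ _ _ (fun x : R => u * sin x) cos); last exact: continuous_cos.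
    by apply: cvgMl_tmp; exact: continuous_sin.
  by apply: (@continuous_comp _ _ _ cos (fun y => y ^+ 2));
    [exact: continuous_cos|exact: exprn_continuous].
have mc (g : R -> R) : continuous g ->
    measurable_fun (`[- h, h] : set (measurableTypeR R)) (EFin \o g).
  move=> cg; apply/measurable_EFinP; apply: measurable_funTS.
  exact: continuous_measurable_fun.
pose f x : R := cos (u * sin x) * cos x ^+ 2.
pose S N x := \sum_(0 <= m < N) T m x.
pose D : set R := [set` `[- h, h]].
have [_ _ H] : [/\ leb.-integrable D (fun x => (f x)%:E),
   (\int[leb]_(x in D) `|(S N x)%:E - (f x)%:E|)%E @[N --> \oo] --> 0%E &
   (\int[leb]_(x in D) (S N x)%:E)%E @[N --> \oo] --> (\int[leb]_(x in D) (f x)%:E)%E].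
  apply: (@dominated_convergence _ _ _ leb D mI
    (fun N x => (S N x)%:E) _ (cst (expR (u ^+ 2))%:E)).
  - by move=> N; exact: (mc _ (cS N)).
  - exact: (mc _ cf).
  - apply: aeW => x _; apply: cvg_EFin; first exact: nearW.
    rewrite /comp /=.
    rewrite /S (_ : (fun N => _) = (fun N => series (cos_coeff' (u * sin x)) N * cos x ^+ 2)).
      by apply: cvgMr_tmp; exact: cvg_cos_coeff'.
    by apply/funext => N; rewrite /series /= mulr_suml.
  - by apply: (@continuous_integrable (cst (expR (u ^+ 2)))) => x; exact: cvg_cst.
  - by apply: aeW => x N _; rewrite /= lee_fin; exact: bnd.
have : (fun N => h * pseries (bescoef R 1) (u ^+ 2 / 4) N) @ \oo -->
    \int[leb]_(x in `[- h, h]) (cos (u * sin x) * cos x ^+ 2).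
  have -> : (fun N => h * pseries (bescoef R 1) (u ^+ 2 / 4) N) =
      fun N => \int[leb]_(x in `[- h, h]) (\sum_(0 <= m < N) T m x).
    by apply/funext => N; rewrite IS.
  apply: fine_cvg; rewrite fineK//.
  by apply: integrable_fin_num => //; exact: continuous_integrable.
move=> /(cvg_lim (@norm_hausdorff _ _)) <-.
apply/cvg_lim => //; apply: cvgMl_tmp; exact: is_cvg_bes.
Qed.

End Poisson.

(** * Disks: area and reduction of the transform to Poisson's integral *)

Section DiskTransform.
Variable R : realType.
Notation leb := (@lebesgue_measure R).
Notation RR := (measurableTypeR R * measurableTypeR R)%type.
Implicit Types (x t u r : R) (z xi : RR).
Let h : R := pi / 2.

Lemma diskE r z : 0 < r -> disk r z <-> z.1 ^+ 2 + z.2 ^+ 2 < r ^+ 2.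
Proof.
move=> r0; rewrite /disk /norm2 /dot2 /= -!expr2.
have d0 : 0 <= z.1 ^+ 2 + z.2 ^+ 2 by rewrite addr_ge0 ?sqr_ge0.
by rewrite -{2}(sqr_sqrtr d0) ltr_pXn2r// nnegrE ?sqrtr_ge0// ltW.
Qed.

Lemma measurable_dot2 xi : measurable_fun setT (fun z : RR => dot2 xi z : R).
Proof. by apply: measurable_funD; apply: measurable_funM. Qed.

Lemma measurable_cos_dot2 xi : measurable_fun setT (fun z : RR => cos (dot2 xi z) : R).
Proof.
apply: measurableT_comp (measurable_dot2 xi).
exact: continuous_measurable_fun (@continuous_cos R).
Qed.

Lemma measurable_norm2 : measurable_fun setT (fun z : RR => norm2 z : R).
Proof.
apply: (@measurableT_comp _ _ _ _ _ _ (@Num.sqrt R)).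
  exact: continuous_measurable_fun (@sqrt_continuous R).
by apply: measurable_funD; apply: measurable_funM.
Qed.

Lemma measurable_disk r : measurable (disk r : set RR).
Proof.
rewrite -[X in measurable X]setTI.
have -> : disk r = (fun z : RR => norm2 z) @^-1` [set` `]-oo, r[].
  by apply/seteqP; split => z; rewrite /disk /= in_itv.
by apply: measurable_norm2 => //; exact: measurable_itv.
Qed.

Lemma vol2_disk_lty r : (vol2 R (disk r) < +oo)%E.
Proof.
have [r0|r0] := leP r 0.
  have -> : disk r = set0 :> set RR.
    apply/seteqP; split => z //; rewrite /disk /= => zr.
    by have := lt_le_trans zr r0; rewrite ltNge sqrtr_ge0.
  by rewrite measure0.
apply: (@le_lt_trans _ _ (vol2 R (`[- r, r]%classic `*` `[- r, r]%classic))).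
  apply: le_measure; rewrite ?inE.
  - exact: measurable_disk.
  - by apply: measurableX; exact: measurable_itv.
  - move=> z /(diskE _ r0) zr; split; rewrite /= in_itv/= -ler_norml;
      rewrite -(@ler_pXn2r _ 2) ?nnegrE// ?(ltW r0)// real_normK ?num_real//.
    + by have := sqr_ge0 z.2; lra.
    + by have := sqr_ge0 z.1; lra.
have := @product_measure1E _ _ _ _ R leb leb _ _
  (measurable_itv `[- r, r]) (measurable_itv `[- r, r]).
rewrite /vol2 /= => ->.
by rewrite lebesgue_measure_itv/=; case: ifP => _; rewrite -?EFinB -?EFinM ?mule0 ltry.
Qed.

Lemma vol2_bounded_lty (D : set RR) r : D `<=` disk r -> measurable D ->
  (vol2 R D < +oo)%E.
Proof.
move=> Dr mD; apply: le_lt_trans (vol2_disk_lty r).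
by apply: le_measure; rewrite ?inE//; exact: measurable_disk.
Qed.

Lemma integrable_cos_dot2 xi (D : set RR) r : D `<=` disk r -> measurable D ->
  (vol2 R).-integrable D (EFin \o (fun z => cos (dot2 xi z))).
Proof.
move=> Dr mD; apply: measurable_bounded_integrable => //.
- exact: vol2_bounded_lty Dr mD.
- by apply: measurable_funTS; exact: measurable_cos_dot2.
- exists 1; split; first exact: num_real.
  by move=> M M1 z _ /=; rewrite (le_trans (cos_max _))// ltW.
Qed.

(** For a frequency on the first axis the integrand is constant on vertical chords, and Fubini
    brings in the chord length. *)
Lemma Rintegral_cos_disk_axis r t : 0 < r ->
  Rintegral (vol2 R) (disk r) (fun z => cos (dot2 (t, 0) z)) =
  \int[leb]_(x in `[- r, r]) (cos (t * x) * (2 * Num.sqrt (r ^+ 2 - x ^+ 2))).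
Proof.
move=> r0; rewrite /Rintegral; congr fine.
rewrite integral_mkcond /=.
have mD := measurable_disk r.
have /integrable_mkcond := @integrable_cos_dot2 (t, 0) (disk r) r (fun _ H => H) mD.
move=> /(_ mD) ig; rewrite -[LHS](integral12_prod_meas1 ig) [RHS]integral_mkcond.
apply: eq_integral => x _; rewrite /fubini_F.
pose s : R := Num.sqrt (r ^+ 2 - x ^+ 2).
pose I : set R := [set` `]- s, s[].
transitivity (\int[leb]_(y in I) (cos (t * x)%R)%:E)%E.
  rewrite [RHS]integral_mkcond; apply: eq_integral => y _.
  rewrite !patchE /dot2 /= mul0r addr0.
  suff -> : ((x, y) \in disk r) = (y \in I) by [].
  apply/idP/idP; rewrite !inE /I /= in_itv/= -ltr_norml.
    move=> /(diskE _ r0) /= H; rewrite -(@ltr_pXn2r _ 2) ?nnegrE ?sqrtr_ge0//.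
    rewrite real_normK ?num_real// sqr_sqrtr; first lra.
    by have := sqr_ge0 y; lra.
  move=> H; apply/(diskE _ r0) => /=.
  have sp : 0 < r ^+ 2 - x ^+ 2 by rewrite -sqrtr_gt0; exact: le_lt_trans H.
  move: H; rewrite -(@ltr_pXn2r _ 2) ?nnegrE ?sqrtr_ge0//.
  rewrite real_normK ?num_real// sqr_sqrtr ?(ltW sp)//; lra.
have sE : (- s < s) = (0 < s) by apply/idP/idP; lra.
rewrite integral_cst//=; last exact: measurable_itv.
rewrite lebesgue_measure_itv/= lte_fin sE.
(* If [s] is 0 the chord is empty. This includes the abscissas outside [-r, r], as the square root
   of a negative number is 0. *)
rewrite patchE; have [sp|] := boolP (0 < s).
  rewrite ifT; first by rewrite -EFinB -EFinM opprK -mulr2n mulr_natl.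
  rewrite inE /= in_itv/= -ler_norml -(@ler_pXn2r _ 2) ?nnegrE ?(ltW r0)//.
  rewrite real_normK ?num_real//.
  by move: sp; rewrite /s sqrtr_gt0 subr_gt0 => /ltW.
rewrite /s sqrtr_gt0 -leNgt => /ler0_sqrtr ->; rewrite mule0 !mulr0.
by case: ifP.
Qed.

(** The substitution x = r sin(theta) leads to Poisson's integral; the square root becomes r
    cos(theta), which is nonnegative on the range. *)
Lemma Rintegral_cos_disk_polar r t : 0 < r ->
  \int[leb]_(x in `[- r, r]) (cos (t * x) * (2 * Num.sqrt (r ^+ 2 - x ^+ 2))) =
  pi * r ^+ 2 * bes 1 (t ^+ 2 * r ^+ 2 / 4).
Proof.
move=> r0; pose F x : R := r * sin x.
pose G x : R := cos (t * x) * (2 * Num.sqrt (r ^+ 2 - x ^+ 2)).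
have DF x : is_derive x 1 F (r * cos x) by apply: is_derive_cmulf; exact: is_derive_sin.
have F'E : (derive1 F) = fun x => r * cos x.
  by apply/funext => x; rewrite derive1E; have [] := DF x.
have cF' : continuous (derive1 F).
  by rewrite F'E => x; apply: cvgMl_tmp; exact: continuous_cos.
have cF : continuous F by move=> x; apply: cvgMl_tmp; exact: continuous_sin.
have cG : continuous G.
  move=> x; apply: cvgM.
    apply: (@continuous_comp _ _ _ (fun x : R => t * x) cos); last exact: continuous_cos.
    by apply: cvgMl_tmp; exact: cvg_id.
  apply: cvgMl_tmp.
  apply: (@continuous_comp _ _ _ (fun x : R => r ^+ 2 - x ^+ 2) Num.sqrt);
    last exact: sqrt_continuous.
  by apply: cvgB; [exact: cvg_cst|exact: exprn_continuous].
have Fh : F h = r by rewrite /F sin_pihalf mulr1.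
have FNh : F (- h) = - r by rewrite /F sinN sin_pihalf mulrN1.
have hh := h_gt0 R.
have S := @integration_by_substitution_increasing R F G (- h) h (ltW hh) _ _ _ _ _ _.
transitivity (\int[leb]_(x in `[- h, h]) (2 * r ^+ 2 * (cos (t * r * sin x) * cos x ^+ 2))).
  rewrite FNh Fh in S; rewrite /Rintegral S.
  - congr fine; apply: eq_integral => x; rewrite inE /= => xh; congr EFin.
    rewrite !fctE F'E /G /F mulrA.
    have c0 : 0 <= cos x by apply: cos_ge0_pihalf; move: xh; rewrite in_itv.
    have -> : r ^+ 2 - (r * sin x) ^+ 2 = (r * cos x) ^+ 2.
      by rewrite exprMn sin2cos2; ring.
    rewrite sqrtr_sqr ger0_norm; last by rewrite mulr_ge0// ltW.
    ring.
  - move=> x y xh yh xy; rewrite /F ltr_pM2l//.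
    by rewrite ltr_sin.
  - by move=> x _; exact: cF'.
  - by apply/cvg_ex; eexists; apply: cvg_at_right_filter; exact: cF'.
  - by apply/cvg_ex; eexists; apply: cvg_at_left_filter; exact: cF'.
  - split.
    + by move=> x _; have [] := DF x.
    + by apply: cvg_at_right_filter; exact: cF.
    + by apply: cvg_at_left_filter; exact: cF.
  - exact: continuous_subspaceT.
rewrite RintegralZl//; last first.
  apply: continuous_integrable => x; apply: cvgM.
    apply: (@continuous_comp _ _ _ (fun x : R => t * r * sin x) cos);
      last exact: continuous_cos.
    by apply: cvgMl_tmp; exact: continuous_sin.
  by apply: (@continuous_comp _ _ _ cos (fun y => y ^+ 2));
    [exact: continuous_cos|exact: exprn_continuous].
rewrite poisson_integral exprMn /h. by field.
Qed.

Lemma Rintegral_rotation (c s : R) (D : set RR) (g : RR -> R) : c ^+ 2 + s ^+ 2 = 1 ->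
  measurable D -> measurable_fun setT g ->
  (vol2 R).-integrable (rotation c s @^-1` D) (EFin \o (g \o rotation c s)) ->
  Rintegral (vol2 R) (rotation c s @^-1` D) (g \o rotation c s) = Rintegral (vol2 R) D g.
Proof.
move=> cs mD mg ig; rewrite /Rintegral; congr fine.
have := @integral_pushforward _ _ _ _ R (rotation c s) (measurable_rotation c s) (vol2 R) D
  (EFin \o g) _ ig mD.
move=> H; rewrite -[LHS]H; last exact/measurable_EFinP.
apply: eq_measure_integral => [|mt A mA _]; first exact: measurable_rotation.
exact: vol2_rotation.

Qed.

Lemma norm2_rotation (c s : R) z : c ^+ 2 + s ^+ 2 = 1 -> norm2 (rotation c s z) = norm2 z.
Proof.
move=> cs; rewrite /norm2 /dot2 /rotation /=; congr Num.sqrt.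
transitivity ((c ^+ 2 + s ^+ 2) * (z.1 * z.1 + z.2 * z.2)); first by ring.
by rewrite cs mul1r.
Qed.

Lemma preimage_rotation_disk (c s : R) r : c ^+ 2 + s ^+ 2 = 1 ->
  rotation c s @^-1` disk r = disk r.
Proof.
by move=> cs; apply/seteqP; split => z; rewrite /disk /= norm2_rotation.
Qed.

Lemma Rintegral_cos_disk r xi : 0 < r ->
  Rintegral (vol2 R) (disk r) (fun z => cos (dot2 xi z)) =
  pi * r ^+ 2 * bes 1 (norm2 xi ^+ 2 / 4 * r ^+ 2).
Proof.
move=> r0; pose t := norm2 xi.
have t2 : t ^+ 2 = xi.1 ^+ 2 + xi.2 ^+ 2.
  by rewrite sqr_sqrtr /dot2 -!expr2// addr_ge0 ?sqr_ge0.
(* A rotation taking [xi] to the first axis; for [xi] = 0 the identity is chosen. *)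
have [c [s [cs cE sE]]] : exists c s : R,
    [/\ c ^+ 2 + s ^+ 2 = 1, t * c = xi.1 & t * s = - xi.2].
  have [t0|t0] := eqVneq t 0.
    exists 1, 0; rewrite t0 !mul0r expr1n expr0n addr0.
    move: t2; rewrite t0 expr0n /= => /esym/eqP.
    by rewrite paddr_eq0 ?sqr_ge0// !sqrf_eq0 => /andP[/eqP -> /eqP ->]; rewrite oppr0.
  exists (xi.1 / t), (- xi.2 / t); split; [|by field|by field].
  by rewrite !exprMn sqrrN -mulrDl -t2 exprVn divff// expf_neq0.
have mD := measurable_disk r.
have E : (fun z : RR => cos (dot2 xi z)) = (fun z => cos (dot2 (t, 0) z)) \o rotation c s.
  have e2 : xi.2 = - (t * s) by rewrite sE opprK.
  apply/funext => z /=; congr cos; rewrite /dot2 /rotation /= -cE e2.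
  by ring.
rewrite E -{1}(preimage_rotation_disk r cs) Rintegral_rotation//.
- rewrite Rintegral_cos_disk_axis// Rintegral_cos_disk_polar//.
  by congr (_ * bes 1 _); rewrite /t; ring.
- exact: measurable_cos_dot2.
- by rewrite preimage_rotation_disk// -E; exact: (@integrable_cos_dot2 _ _ r).
Qed.

(** The area is the transform at frequency 0. *)
Lemma vol2_disk r : 0 < r -> vol2 R (disk r) = (pi * r ^+ 2)%:E.
Proof.
move=> r0; have := @Rintegral_cos_disk r (0, 0) r0.
have -> : norm2 ((0, 0) : RR) = 0 by rewrite /norm2 /dot2 /= !mul0r addr0 sqrtr0.
under eq_Rintegral do rewrite /dot2 /= !mul0r addr0 cos0.
rewrite Rintegral_cst; last exact: measurable_disk.
rewrite mul1r expr0n /= !mul0r bes0 invr1 mulr1 => <-.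
by rewrite fineK// ge0_fin_numE// vol2_disk_lty.
Qed.

End DiskTransform.

(** * Cones of repeated squarings *)

Section Cone.
Variable R : realType.
Notation leb := (@lebesgue_measure R).
Notation RR := (measurableTypeR R * measurableTypeR R)%type.
Implicit Types (x t u r a : R) (z xi w : R * R) (k : nat).

Definition csqr z : R * R := (z.1 ^+ 2 - z.2 ^+ 2, 2 * z.1 * z.2).

(* The complex power [z ^+ (2 ^ k)], by repeated squaring. *)
Definition cpow2 k z : R * R := iter k csqr z.

Lemma csqr_rotation a z :
  csqr (rotation (cos a) (sin a) z) = rotation (cos (a *+ 2)) (sin (a *+ 2)) (csqr z).
Proof.
rewrite /csqr /rotation /= cos_mulr2n sin_mulr2n.
have e : 1 = cos a ^+ 2 + sin a ^+ 2 by rewrite cos2Dsin2.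
rewrite [in _ *+ 2 - _]e; congr (_, _); ring.
Qed.

Lemma cpow2_rotation k a z : cpow2 k (rotation (cos a) (sin a) z) =
  rotation (cos (a *+ 2 ^ k)) (sin (a *+ 2 ^ k)) (cpow2 k z).
Proof.
elim: k => [|k IH]; first by rewrite mulr1n.
by rewrite /cpow2 !iterS -/(cpow2 k _) IH csqr_rotation -mulrnA expnSr.
Qed.

Definition step_angle k : R := (pi / 2) / (2 ^ k)%:R.

Definition turn k : R * R -> R * R := rotation (cos (step_angle k)) (sin (step_angle k)).

(** The angle of [turn k] is a quarter turn divided by 2^k, so [turn k] multiplies the power by i.
    Successive turns thus permute the four quadrants of [cpow2 k]. *)
Lemma cpow2_turn k z : cpow2 k (turn k z) = (- (cpow2 k z).2, (cpow2 k z).1).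
Proof.
have e : step_angle k *+ 2 ^ k = pi / 2.
  by rewrite -[LHS]mulr_natr divfK// pnatr_eq0 -lt0n expn_gt0.
rewrite cpow2_rotation e.
by rewrite cos_pihalf sin_pihalf /rotation !mul0r !mul1r add0r addr0.
Qed.

Lemma cpow2_scale k t z : cpow2 k (t *: z) = t ^+ (2 ^ k) *: cpow2 k z.
Proof.
elim: k => [|k IH]; first by rewrite expr1.
rewrite /cpow2 !iterS -/(cpow2 k _) IH expnSr exprM.
rewrite /csqr; congr (_, _); rewrite /= /GRing.scale /=; ring.
Qed.

(** At least one squaring is needed to absorb the sign, whence the index [k.+1] in the final
    domain. *)
Lemma cpow2_opp k z : cpow2 k.+1 (- z) = cpow2 k.+1 z.
Proof.
by rewrite /cpow2 !iterSr; congr iter; rewrite /csqr /=; congr (_, _); ring.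
Qed.

Lemma continuous_cpow2 k :
  continuous (fun z : R * R => (cpow2 k z).1) /\ continuous (fun z : R * R => (cpow2 k z).2).
Proof.
elim: k => [|k [IH1 IH2]].
  by split => z; [exact: cvg_fst|exact: cvg_snd].
split => z.
  apply: cvgB.
    apply: (@continuous_comp _ _ _ (fun z => (cpow2 k z).1) (fun y => y ^+ 2)).
      exact: IH1.
    exact: exprn_continuous.
  apply: (@continuous_comp _ _ _ (fun z => (cpow2 k z).2) (fun y => y ^+ 2)).
    exact: IH2.
  exact: exprn_continuous.
by apply: cvgM; [apply: cvgMl_tmp; exact: IH1|exact: IH2].
Qed.

Lemma measurable_cpow2 k :
  measurable_fun setT (fun z : RR => (cpow2 k z).1 : measurableTypeR R) /\
  measurable_fun setT (fun z : RR => (cpow2 k z).2 : measurableTypeR R).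
Proof.
elim: k => [|k [IH1 IH2]]; first by split; [exact: measurable_fst|exact: measurable_snd].
split; first by apply: measurable_funB; apply: measurable_funX.
by apply: measurable_funM => //; apply: measurable_funM.
Qed.

Definition cone k : set (R * R) := [set z | 0 < (cpow2 k z).1 /\ 0 < (cpow2 k z).2].

Lemma open_cone k : open (cone k).
Proof.
have [c1 c2] := continuous_cpow2 k.
apply: openI.
  apply: (@open_comp _ _ (fun z => (cpow2 k z).1) [set x | 0 < x]); last exact: open_gt.
  by move=> z _; exact: c1.
apply: (@open_comp _ _ (fun z => (cpow2 k z).2) [set x | 0 < x]); last exact: open_gt.
by move=> z _; exact: c2.
Qed.

Lemma measurable_cone k : measurable (cone k : set RR).
Proof.
have [m1 m2] := measurable_cpow2 k.
have P (f : RR -> measurableTypeR R) : measurable_fun setT f ->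
    measurable ([set z | 0 < f z] : set RR).
  move=> mf; rewrite -[X in measurable X]setTI.
  have -> : [set z : RR | 0 < f z] = f @^-1` [set` `]0, +oo[].
    by apply/seteqP; split => z /=; rewrite in_itv/= andbT.
  by apply: mf => //; exact: measurable_itv.
by apply: measurableI; apply: P.
Qed.

Lemma measurable_turn k (A : set RR) : measurable A -> measurable (turn k @^-1` A : set RR).
Proof.
by move=> mA; rewrite -[X in measurable X]setTI; exact: measurable_rotation.
Qed.

(* The lines through the origin on which [cpow2 k z] is real. *)
Definition axes k : set RR := [set z | (cpow2 k z).2 = 0].

Lemma measurable_axes k : measurable (axes k).
Proof.
have [_ m2] := measurable_cpow2 k.
rewrite -[X in measurable X]setTI.
have -> : axes k = (fun z : RR => (cpow2 k z).2 : measurableTypeR R) @^-1` [set 0] by [].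
by apply: m2 => //; exact: measurable_set1.
Qed.

Lemma axesS k : axes k.+1 = axes k `|` turn k @^-1` axes k.
Proof.
apply/seteqP; split => z; rewrite /axes /= cpow2_turn /=.
  by move=> /eqP; rewrite !mulf_eq0 pnatr_eq0 /= => /orP[/eqP|/eqP]; [right|left].
by move=> [->|->]; rewrite ?mulr0 ?mul0r.
Qed.

(** By induction: each squaring adds a rotated copy of the previous lines, starting from a single
    coordinate axis. *)
Lemma vol2_axes k : vol2 R (axes k) = 0%E.
Proof.
elim: k => [|k IH].
  have -> : axes 0 = setT `*` [set 0].
    by apply/seteqP; split => [z zz|z [_ zz]].
  have := @product_measure1E _ _ _ _ R leb leb setT [set 0] measurableT
    (measurable_set1 0).
  by rewrite /vol2 /= => ->; rewrite lebesgue_measure_set1 mule0.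
have mA := measurable_axes k.
have mt := measurable_turn k mA.
apply/eqP; rewrite axesS -measure_le0.
apply: (le_trans (measureU2 _ mA mt)).
have e : vol2 R (turn k @^-1` axes k) = 0%E.
  by rewrite -IH; apply: vol2_rotation => //; exact: cos2Dsin2.
apply: (@le_trans _ _ (0 + 0)%E); last by rewrite adde0.
have l1 : (vol2 R (axes k) <= 0)%E by rewrite IH.
have l2 : (vol2 R (turn k @^-1` axes k) <= 0)%E by rewrite e.
exact: leeD l1 l2.
Qed.

End Cone.

(** * Comparison of the four rotated copies of the cone *)

Section Sectors.
Variable R : realType.
Notation RR := (measurableTypeR R * measurableTypeR R)%type.
Notation mu := (vol2 R).
Implicit Types (x t u r a : R) (z xi w : R * R) (k : nat).

Lemma normr_Rintegral_le (D : set RR) (g : RR -> R) (M : R) :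
  measurable D -> (mu D < +oo)%E -> mu.-integrable D (EFin \o g) ->
  (forall z, D z -> `|g z| <= M) -> `|Rintegral mu D g| <= M * fine (mu D).
Proof.
move=> mD Doo ig gM; apply: le_trans (le_normr_Rintegral mD ig) _.
rewrite -(Rintegral_cst mu mD M); apply: le_Rintegral => //.
  exact: (integrable_norm ig).
apply: measurable_bounded_integrable => //.
exists `|M|; split; first exact: num_real.
by move=> y My z _ /=; rewrite ltW.
Qed.

Variables (r1 r2 : R) (k : nat) (xi : R * R) (e : R).
Hypotheses (r1_gt0 : 0 < r1) (r12 : r1 < r2).
Hypothesis turn_close : forall z, disk r2 z ->
  `|cos (dot2 xi z) - cos (dot2 xi (turn k z))| <= e.

Let g (z : RR) : R := cos (dot2 xi z).
Let A : set RR := disk r2 `\` disk r1.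
Let V : R := fine (mu (disk r2)).

(** For i < 4 these are the parts of the annulus [A] lying over the four open quadrants of
    [cpow2 k]. *)
Let Q (i : nat) : set RR := iter i (fun D => turn k @^-1` D) (A `&` cone k).

Let mA : measurable A.
Proof. by apply: measurableD; exact: measurable_disk. Qed.

Let A_disk : A `<=` disk r2.
Proof. by move=> z []. Qed.

Let turnA z : A (turn k z) = A z.
Proof.
have cs := cos2Dsin2 (step_angle R k).
by rewrite /A /turn /disk /= !norm2_rotation.
Qed.

Let mQ i : measurable (Q i).
Proof.
elim: i => [|i IH]; first by apply: measurableI => //; exact: measurable_cone.
exact: measurable_turn.
Qed.

Let QA i : Q i `<=` A.
Proof.
elim: i => [|i IH] z; first by case.
by move=> /IH; rewrite turnA.
Qed.

Let Q_disk i : Q i `<=` disk r2.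
Proof. by move=> z /QA /A_disk. Qed.

Let Q0E z : Q 0 z <-> [/\ A z, 0 < (cpow2 k z).1 & 0 < (cpow2 k z).2].
Proof. by rewrite /Q /= /cone /=; split => [[? []]|[]]. Qed.

Let Q1E z : Q 1 z <-> [/\ A z, 0 < - (cpow2 k z).2 & 0 < (cpow2 k z).1].
Proof. by apply: iff_trans (Q0E (turn k z)) _; rewrite cpow2_turn turnA. Qed.

Let Q2E z : Q 2 z <-> [/\ A z, 0 < - (cpow2 k z).1 & 0 < - (cpow2 k z).2].
Proof. by apply: iff_trans (Q1E (turn k z)) _; rewrite cpow2_turn turnA. Qed.

Let Q3E z : Q 3 z <-> [/\ A z, 0 < - - (cpow2 k z).2 & 0 < - (cpow2 k z).1].
Proof. by apply: iff_trans (Q2E (turn k z)) _; rewrite cpow2_turn turnA. Qed.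

Let ig (D : set RR) : measurable D -> D `<=` disk r2 -> mu.-integrable D (EFin \o g).
Proof. by move=> mD Dr; exact: integrable_cos_dot2 Dr mD. Qed.

Let Iq (D : set RR) : R := Rintegral mu D g.

Let IqU (D D' : set RR) : measurable D -> measurable D' -> D `<=` disk r2 -> D' `<=` disk r2 ->
  (forall z, D z -> D' z -> False) -> Iq (D `|` D') = Iq D + Iq D'.
Proof.
move=> mD mD' Dr D'r dis; apply: Rintegral_setU => //.
  by apply: ig; [exact: measurableU|move=> z [/Dr|/D'r]].
by apply/disj_setPS => z [/dis].
Qed.

(** The four pieces are disjoint and miss only points where a coordinate of [cpow2 k] vanishes, that
    is, points of the null set [axes k.+1]. *)
Let IqA : Iq A = Iq (Q 0) + Iq (Q 1) + (Iq (Q 2) + Iq (Q 3)).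
Proof.
have mZ : measurable (A `&` @axes R k.+1).
  by apply: measurableI => //; exact: measurable_axes.
have Z0 : Iq (A `&` @axes R k.+1) = 0.
  rewrite /Iq /Rintegral null_set_integral//.
    by apply/measurable_EFinP; apply: measurable_funTS; exact: measurable_cos_dot2.
  apply/eqP; rewrite -measure_le0 -(vol2_axes R k.+1).
  by apply: le_measure; rewrite ?inE//; exact: measurable_axes.
have -> : A = ((Q 0 `|` Q 1) `|` (Q 2 `|` Q 3)) `|` (A `&` @axes R k.+1).
  apply/seteqP; split => z; last first.
    by move=> [[[|]|[|]]|[]//]; exact: QA.
  move=> Az.
  have H : axes k.+1 z <-> (cpow2 k z).1 = 0 \/ (cpow2 k z).2 = 0.
    rewrite axesS /axes /= cpow2_turn /=; tauto.
  have [w10|w10|w10] := ltrgtP 0 (cpow2 k z).1; last by right; split => //; apply/H; left.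
  - have [w20|w20|w20] := ltrgtP 0 (cpow2 k z).2; last by right; split => //; apply/H; right.
    + by left; left; left; apply/Q0E.
    + by left; left; right; apply/Q1E; rewrite oppr_gt0.
  - have [w20|w20|w20] := ltrgtP 0 (cpow2 k z).2; last by right; split => //; apply/H; right.
    + by left; right; right; apply/Q3E; rewrite opprK oppr_gt0.
    + by left; right; left; apply/Q2E; rewrite !oppr_gt0.
have mU := measurableU.
have ax z : (cpow2 k z).1 != 0 -> (cpow2 k z).2 != 0 -> ~ axes k.+1 z.
  move=> w1 w2; rewrite axesS /axes /= cpow2_turn /= => -[/eqP|/eqP];
    [by rewrite (negbTE w2)|by rewrite (negbTE w1)].
have sQ i j : Q i `|` Q j `<=` disk r2 by move=> z [/Q_disk|/Q_disk].
have d01 z : Q 0 z -> Q 1 z -> False by move=> /Q0E[_ h1 h2] /Q1E[_ h3 h4]; lra.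
have d23 z : Q 2 z -> Q 3 z -> False by move=> /Q2E[_ h1 h2] /Q3E[_ h3 h4]; lra.
have d0123 z : (Q 0 `|` Q 1) z -> (Q 2 `|` Q 3) z -> False.
  by move=> [/Q0E[_ h1 h2]|/Q1E[_ h1 h2]] [/Q2E[_ h3 h4]|/Q3E[_ h3 h4]]; lra.
have dZ z : ((Q 0 `|` Q 1) `|` (Q 2 `|` Q 3)) z -> (A `&` @axes R k.+1) z -> False.
  move=> Hz [_]; apply: ax; apply/eqP => w0; move: Hz => [[/Q0E|/Q1E]|[/Q2E|/Q3E]] [_];
    rewrite w0; lra.
have mQ01 : measurable (Q 0 `|` Q 1) by exact: mU.
have mQ23 : measurable (Q 2 `|` Q 3) by exact: mU.
rewrite (IqU _ _ _ _ dZ)//; last 3 first.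
- exact: mU.
- by move=> z [/sQ|/sQ].
- by move=> z [/A_disk].
by rewrite Z0 addr0 (IqU _ _ _ _ d0123)// (IqU _ _ _ _ d01)// (IqU _ _ _ _ d23).
Qed.

(** Rotation invariance writes the integral over [Q i] as one of [g \o turn k] over [Q i.+1], where
    the two integrands differ by at most [e]. *)
Let Iq_step i : `|Iq (Q i.+1) - Iq (Q i)| <= e * V.
Proof.
have cs := cos2Dsin2 (step_angle R k).
(* Evaluating [turn_close] at the origin gives the sign of [e]. *)
have e0 : 0 <= e.
  have d0 : disk r2 (0 : R, 0 : R).
    rewrite /disk /norm2 /dot2 /= mul0r addr0 sqrtr0; exact: lt_trans r12.
  by apply: le_trans (turn_close d0).
have mg : measurable_fun setT g by exact: measurable_cos_dot2.
have it : mu.-integrable (Q i.+1) (EFin \o (g \o turn k)).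
  apply: measurable_bounded_integrable => //.
  - exact: vol2_bounded_lty (@Q_disk i.+1) (mQ i.+1).
  - apply: measurable_funTS; apply: measurableT_comp mg _; exact: measurable_rotation.
  - exists 1; split; first exact: num_real.
    by move=> M M1 z _ /=; rewrite (le_trans (cos_max _))// ltW.
have <- : Rintegral mu (Q i.+1) (g \o turn k) = Iq (Q i).
  by apply: Rintegral_rotation => //; exact: mQ.
have iQ := ig (mQ i.+1) (@Q_disk i.+1).
rewrite /Iq -RintegralB//.
apply: (@le_trans _ _ (e * fine (mu (Q i.+1)))).
  apply: normr_Rintegral_le => //.
  - exact: vol2_bounded_lty (@Q_disk i.+1) (mQ i.+1).
  - have := integrableB (mQ i.+1) iQ it; by [].
  - by move=> z Qz; apply: turn_close; exact: Q_disk Qz.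
rewrite ler_wpM2l// fine_le//.
- by rewrite ge0_fin_numE//; exact: vol2_bounded_lty (@Q_disk i.+1) (mQ i.+1).
- by rewrite ge0_fin_numE//; exact: vol2_disk_lty.
- apply: le_measure; rewrite ?inE; [exact: mQ|exact: measurable_disk|exact: Q_disk].
Qed.

(** The difference equals the sum of [Iq (Q 0) - Iq (Q i)] for i = 1, 2, 3. These take 1, 2 and 3
    steps of size at most [e * V], which explains the factor 6. *)
Lemma Rintegral_quarter :
  `|4 * Rintegral mu (disk r1 `|` (disk r2 `&` cone k)) g -
    (3 * Rintegral mu (disk r1) g + Rintegral mu (disk r2) g)| <= 6 * e * V.
Proof.
have s12 : disk r1 `<=` disk r2 by move=> z; rewrite /disk /= => /lt_trans; apply.
have md1 := measurable_disk (r1 : R).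
have -> : disk r1 `|` (disk r2 `&` cone k) = disk r1 `|` Q 0.
  apply/seteqP; split => z.
    move=> [|[d2 cz]]; first by left.
    by have [d1|d1] := pselect (disk r1 z); [left|right].
  by move=> [|[[d2 _] cz]]; [left|right].
have E2 : Rintegral mu (disk r2) g = Iq (disk r1) + Iq A.
  rewrite -IqU//; last by move=> z d1 [].
  by rewrite /A setDUK.
rewrite -/(Iq _) IqU//; last by move=> z d1 [[_ nd1] _]; exact: nd1.
rewrite E2 -!/(Iq _) IqA.
have := Iq_step 0; have := Iq_step 1; have := Iq_step 2.
rewrite !ler_norml => /andP[? ?] /andP[? ?] /andP[? ?]; apply/andP; split; lra.
Qed.

End Sectors.

(** * The domain *)

Section ConeDomain.
Variable R : realType.
Implicit Types (x y t u r a : R) (z xi w : R * R) (k : nat).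

Lemma cos_lipschitz x y : `|cos x - cos y| <= `|x - y|.
Proof.
wlog xy : x y / x <= y => [H|].
  by have [/H//|/ltW/H] := leP x y; rewrite distrC [leRHS]distrC.
move: xy; rewrite le_eqVlt => /predU1P[->|xy]; first by rewrite subrr normr0.
have [c _ H] := MVT_global (fun x => is_derive_cos x) xy.
rewrite distrC H normrM normrN [leRHS]distrC ler_piMl//.
exact: sin_max.
Qed.

Lemma norm2_fst z : `|z.1| <= norm2 z.
Proof.
rewrite /norm2 /dot2 -!expr2 -sqrtr_sqr ler_wsqrtr// lerDl; exact: sqr_ge0.
Qed.

Lemma norm2_snd z : `|z.2| <= norm2 z.
Proof.
rewrite /norm2 /dot2 -!expr2 -sqrtr_sqr ler_wsqrtr// lerDr; exact: sqr_ge0.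
Qed.

Lemma norm2_ge0 z : 0 <= norm2 z.
Proof. exact: sqrtr_ge0. Qed.

Lemma cos_dot2_turn k xi z (T r : R) : norm2 xi <= T -> norm2 z <= r ->
  `|cos (dot2 xi z) - cos (dot2 xi (turn k z))| <=
  2 * T * r * (`|1 - cos (step_angle R k)| + `|sin (step_angle R k)|).
Proof.
move=> xT zr; apply: le_trans (cos_lipschitz _ _) _.
set c := cos _; set s := sin _.
have -> : dot2 xi z - dot2 xi (turn k z) =
    (xi.1 * z.1 + xi.2 * z.2) * (1 - c) + (xi.1 * z.2 - xi.2 * z.1) * s.
  by rewrite /dot2 /turn /rotation /= -/c -/s; ring.
have B (p q : R) : `|p| <= T -> `|q| <= r -> `|p * q| <= T * r.
  by move=> pT qr; rewrite normrM ler_pM.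
have x1 := le_trans (norm2_fst xi) xT; have x2 := le_trans (norm2_snd xi) xT.
have z1 := le_trans (norm2_fst z) zr; have z2 := le_trans (norm2_snd z) zr.
have e1 : `|xi.1 * z.1 + xi.2 * z.2| <= 2 * T * r.
  by apply: le_trans (ler_normD _ _) _; have := B _ _ x1 z1; have := B _ _ x2 z2; lra.
have e2 : `|xi.1 * z.2 - xi.2 * z.1| <= 2 * T * r.
  by apply: le_trans (ler_normB _ _) _; have := B _ _ x1 z2; have := B _ _ x2 z1; lra.
apply: le_trans (ler_normD _ _) _.
by rewrite !normrM mulrDr lerD// ler_wpM2r.
Qed.

Lemma small_turn (e : R) : 0 < e ->
  exists k, `|1 - cos (step_angle R k.+1)| + `|sin (step_angle R k.+1)| < e.
Proof.
move=> e0.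
have cf : {for 0, continuous (fun x : R => - (`|1 - cos x| + `|sin x|))}.
  apply: cvgN; apply: cvgD; apply: cvg_norm; last exact: continuous_sin.
  by apply: cvgB; [exact: cvg_cst|exact: continuous_cos].
have f0 : - e < - (`|1 - cos 0| + `|sin (0 : R)|).
  by rewrite cos0 sin0 subrr normr0 addr0 oppr0 oppr_lt0.
have [d d0 Hd] := near_gt cf f0.
have [n nd] : exists n : nat, pi / 2 / d <= n%:R.
  exists (Num.bound (pi / 2 / d)); apply/ltW/archi_boundP.
  by rewrite !divr_ge0// ?pi_ge0// ltW.
exists n; rewrite -ltrN2; apply: Hd.
rewrite subr0 /step_angle ger0_norm; last by rewrite !divr_ge0// pi_ge0.
rewrite ler_pdivrMr ?ltr0n ?expn_gt0//.
move: nd; rewrite ler_pdivrMr// => /le_trans; apply.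
rewrite mulrC ler_wpM2l ?(ltW d0)// ler_nat.
by apply: ltnW; apply: ltn_trans (ltn_expl _ _).
Qed.

Lemma disk_le r1 r2 : r1 <= r2 -> disk r1 `<=` (disk r2 : set (R * R)).
Proof. by move=> rr z; rewrite /disk /= => /lt_le_trans; apply. Qed.

Lemma norm2_scale t z : 0 <= t -> norm2 (t *: z) = t * norm2 z.
Proof.
move=> t0; rewrite /norm2 /dot2 /= /GRing.scale /=.
have -> : t * z.1 * (t * z.1) + t * z.2 * (t * z.2) =
  t ^+ 2 * (z.1 * z.1 + z.2 * z.2) by ring.
by rewrite sqrtrM ?sqr_ge0// sqrtr_sqr ger0_norm.
Qed.

Lemma open_disk r : open (disk r : set (R * R)).
Proof.
apply: (@open_comp _ _ (fun z : R * R => norm2 z) [set x | x < r]); last exact: open_lt.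
move=> z _; apply: (@continuous_comp _ _ _ (fun z : R * R => dot2 z z) (@Num.sqrt R)).
  by apply: cvgD; apply: cvgM; [exact: cvg_fst..|exact: cvg_snd|exact: cvg_snd].
exact: sqrt_continuous.
Qed.

Definition cone_domain r1 r2 k : set (R * R) := disk r1 `|` (disk r2 `&` cone k).

Lemma domain_cone_domain r1 r2 k : r1 <= r2 -> domain (cone_domain r1 r2 k).
Proof.
move=> rr; split; last first.
  by apply: openU; [exact: open_disk|apply: openI; [exact: open_disk|exact: open_cone]].
exists r2; split; first exact: num_real.
move=> M rM z Oz /=.
have zr : norm2 z < r2 by case: Oz => [/(disk_le rr)|[]].
by rewrite prod_normE /= ge_max (le_trans (norm2_fst z)) ?(le_trans (norm2_snd z))//;
  apply/ltW/(lt_trans zr).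
Qed.

Lemma norm2_opp z : norm2 (- z) = norm2 z.
Proof. by rewrite /norm2 /dot2 /= !mulrNN. Qed.

Lemma balanced_cone_domain r1 r2 k : balanced (cone_domain r1 r2 k.+1).
Proof.
have N z : cone_domain r1 r2 k.+1 z -> cone_domain r1 r2 k.+1 (- z).
  by rewrite /cone_domain /setU /setI /disk /cone /mkset norm2_opp !cpow2_opp.
apply/seteqP; split => z; first by move=> [y /N Oy <-].
by move=> /N Oz; exists (- z) => //; rewrite opprK.
Qed.

Lemma star_shaped_cone_domain r1 r2 k : 0 < r1 -> star_shaped (cone_domain r1 r2 k).
Proof.
move=> r0 z Oz t /andP[]; rewrite le_eqVlt => /predU1P[<- _|t0 t1].
  by left; rewrite /disk /= norm2_scale// mul0r.
have d r : disk r z -> disk r (t *: z).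
  rewrite /disk /= norm2_scale ?ltW//; apply: le_lt_trans.
  by rewrite ler_piMl// norm2_ge0.
case: Oz => [/d|[/d dz [c1 c2]]]; first by left.
right; split=> //; rewrite /cone /= cpow2_scale /= /GRing.scale /=.
by rewrite !pmulr_rgt0// exprn_gt0.
Qed.

End ConeDomain.

Theorem theorem2p8 (R : realType) (delta : R) (hdelta : 0 < delta) :
  exists Omega : set (R * R),
    [/\ domain Omega, balanced Omega & star_shaped Omega] /\
    [/\ vol2 R Omega = (pi : R)%:E,
        disk (1 - delta) `<=` Omega,
        Omega `<=` disk (1 + delta)
      & ((j11 R)%:E < kappa Omega)%E].
Proof.
have d2 : 0 < Num.min (delta / 2) 1 by rewrite lt_min ltr01 divr_gt0.
have [b [eta [c [/andP[b0]]]]] := two_radii_bounded_below d2.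
rewrite lt_min => /andP[bd b1] _ eta0 c0 Hc.
have [j0 _ _] := j11_spec R.
pose z1 := j11 R ^+ 2 / 4 + eta.
have z10 : 0 < z1 by rewrite addr_gt0// divr_gt0// exprn_gt0.
pose T := 2 * Num.sqrt z1.
have T2 : T ^+ 2 = 4 * z1.
  by rewrite exprMn sqr_sqrtr ?(ltW z10)//; congr (_ * _); ring.
have T0 : 0 < T by rewrite mulr_gt0 ?sqrtr_gt0.
have jT : j11 R < T.
  by rewrite -(@ltr_pXn2r _ 2) ?nnegrE ?ltW// T2 /z1; lra.
pose r1 := Num.sqrt (1 - b); pose r2 := Num.sqrt (1 + 3 * b).
have r1E : r1 ^+ 2 = 1 - b by rewrite sqr_sqrtr//; lra.
have r2E : r2 ^+ 2 = 1 + 3 * b by rewrite sqr_sqrtr//; lra.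
have r10 : 0 < r1 by rewrite sqrtr_gt0; lra.
have r20 : 0 < r2 by rewrite sqrtr_gt0; lra.
have r12 : r1 < r2 by rewrite -(@ltr_pXn2r _ 2) ?nnegrE ?ltW// r1E r2E; lra.
have pi0 := pi_gt0 R.
pose e := c / (7 * (1 + 3 * b)).
have e0 : 0 < e by rewrite divr_gt0// mulr_gt0//; lra.
pose e' := e / (2 * T * r2).
have Tr0 : 0 < 2 * T * r2 by rewrite mulr_gt0// mulr_gt0.
have e'0 : 0 < e' by rewrite divr_gt0.
have [k Hk] := small_turn e'0.
pose O := cone_domain r1 r2 k.+1.
have close xi : norm2 xi <= T -> forall z, disk r2 z ->
    `|cos (dot2 xi z) - cos (dot2 xi (turn k.+1 z))| <= e.
  move=> xT z zr; apply: le_trans (cos_dot2_turn _ xT (ltW zr)) _.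
  by rewrite mulrC -ler_pdivlMr//; exact: ltW.
have V2 : fine (vol2 R (disk r2)) = pi * (1 + 3 * b) by rewrite vol2_disk// r2E.
have E xi : 3 * Rintegral (vol2 R) (disk r1) (fun z => cos (dot2 xi z)) +
    Rintegral (vol2 R) (disk r2) (fun z => cos (dot2 xi z)) =
    pi * two_radii b (norm2 xi ^+ 2 / 4).
  by rewrite !Rintegral_cos_disk// r1E r2E /two_radii; ring.
have mO : measurable (O : set (measurableTypeR R * measurableTypeR R)).
  apply: measurableU; first exact: measurable_disk.
  by apply: measurableI; [exact: measurable_disk|exact: measurable_cone].
have Or2 : O `<=` disk r2.
  by move=> z [/(disk_le (ltW r12))|[]].
exists O; split; first split.
- exact: domain_cone_domain (ltW r12).
- exact: balanced_cone_domain.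
- exact: star_shaped_cone_domain.
split.
- have close0 z : disk r2 z ->
      `|cos (dot2 (0, 0) z) - cos (dot2 (0, 0) (turn k.+1 z))| <= 0.
    by move=> _; rewrite /dot2 /= !mul0r subrr normr0.
  have := Rintegral_quarter r10 r12 close0.
  rewrite -/(cone_domain _ _ _) -/O E mulr0 mul0r normr_le0 subr_eq0.
  have -> : norm2 ((0, 0) : R * R) = 0 by rewrite /norm2 /dot2 /= !mul0r addr0 sqrtr0.
  rewrite expr0n /= !mul0r /two_radii !mul0r bes0 invr1.
  under eq_Rintegral do rewrite /dot2 /= !mul0r addr0 cos0.
  rewrite Rintegral_cst// mul1r => /eqP H.
  have {}H : fine (vol2 R O) = pi by lra.
  by rewrite -H fineK// ge0_fin_numE//; exact: vol2_bounded_lty Or2 mO.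
- move=> z zd; left; apply: disk_le zd.
  have [dl|dl] := leP delta 1; last by rewrite (le_trans _ (ltW r10))//; lra.
  rewrite -(@ler_pXn2r _ 2) ?nnegrE ?(ltW r10) ?subr_ge0// r1E.
  have : 0 <= delta * (1 - delta) by rewrite mulr_ge0 ?subr_ge0// ltW.
  rewrite expr2; lra.
- move=> z /Or2; apply: disk_le.
  rewrite -(@ler_pXn2r _ 2) ?nnegrE ?(ltW r20)//; last by lra.
  rewrite r2E expr2; have := sqr_ge0 delta; rewrite expr2; lra.
apply: (@lt_le_trans _ _ T%:E); first by rewrite lte_fin.
apply: le_ereal_inf_tmp => _ [xi Nxi <-]; rewrite lee_fin leNgt; apply/negP => xiT.
have xz : 0 <= norm2 xi ^+ 2 / 4 <= z1.
  rewrite divr_ge0 ?sqr_ge0//=.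
  have : norm2 xi ^+ 2 < T ^+ 2 by rewrite ltr_pXn2r// nnegrE ?norm2_ge0// ltW.
  rewrite T2; lra.
have := Rintegral_quarter r10 r12 (close _ (ltW xiT)).
rewrite -/(cone_domain _ _ _) -/O E V2.
have -> : Rintegral (vol2 R) O (fun z => cos (dot2 xi z)) = 0.
  by move: Nxi; rewrite /null_set /= /fourier_indic => -[].
rewrite mulr0 sub0r normrN => H.
have := Hc _ xz; have := le_trans (ler_norm _) H.
have -> : 6 * e * (pi * (1 + 3 * b)) = pi * (6 / 7 * c).
  by rewrite /e; field; lra.
rewrite ler_pM2l//; lra.
Qed.
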